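(* Let $A$ be an $n\times n$ complex matrix, $L\in\mathcal L_{\mathbb C}(A)$, and let $M$ be the multiplicity rearrangement matrix for $(A,L)$. 1. For each nonzero eigenvalue $\lambda$ of $A$ there exists a partition of the multiset $\mathcal B_{JCF}(\lambda,A)$ into (possibly empty) multisets $\mathcal B(\lambda,\nu)$, $\nu\in\sigma_*(L)$, such that $M[\lambda,\nu]$ is equal to the sum of the elements of $\mathcal B(\lambda,\nu)$ (the sum being $0$ if $\mathcal B(\lambda,\nu)$ is empty). In particular, the sum of the elements in the $\lambda$-row of $M$ is equal to $\mathrm{mult}(\lambda,A)$. 2. For each $\nu\in\sigma_*(L)$, the sum of the elements in the $\nu$-column of $M$ is equal to $\mathrm{mult}(\nu,L)$. 3. For $\lambda\in\sigma_*(A)$ we have $\mathcal E(\lambda,A)\subseteq\mathrm{span}\{\mathcal E(\nu,L) : \nu\in\sigma_*(L),\ M[\lambda,\nu]\neq0\}$, and if all $\nu\in\sigma_*(L)$ with $M[\lambda,\nu]\ne0$ satisfy $\mathrm{mult}(\nu,L)=M[\lambda,\nu]$, then the two sets are the same. 4. For $\nu\in\sigma_*(L)$ we have $\mathcal E(\nu,L)\subseteq\mathrm{span}\{\mathcal E(\lambda,A) : \lambda\in\sigma_*(A),\ M[\lambda,\nu]\ne0\}$, and if all $\lambda\in\sigma_*(A)$ with $M[\lambda,\nu]\neq0$ satisfy $\mathrm{mult}(\lambda,A)=M[\lambda,\nu]$, then the two sets are the same.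
   Context: For an $n\times n$ complex matrix $A$, $\mathcal L_{\mathbb C}(A)$ is the set of all matrices $L$ for which there exist a strictly increasing sequence $(c_i)_{i\ge1}$ of positive integers and a convergent sequence $(B_i)_{i\ge1}$ of $n\times n$ complex matrices with $B_i^{c_i}=A$ for all $i$ and $\lim_{i\to\infty}B_i=L$. For a square matrix $X$: $\sigma_*(X)$ is the set of distinct nonzero eigenvalues of $X$; $\mathrm{mult}(\lambda,X)$ is the algebraic multiplicity of $\lambda$ as an eigenvalue of $X$; $\mathcal E(\lambda,X)$ is the generalised (right) eigenspace of $X$ for the eigenvalue $\lambda$; $\mathcal B_{JCF}(\lambda,X)$ is the multiset of sizes of the Jordan blocks with eigenvalue $\lambda$ in the Jordan canonical form of $X$. A partition of a multiset is a division of it into non-overlapping sub-multisets whose union is the original multiset. The multiplicity rearrangement matrix $M$ for $(A,L)$ is the matrix with rows indexed by $\sigma_*(A)$ and columns indexed by $\sigma_*(L)$ (in some fixed order), with entries $M[\lambda,\nu]:=\dim(\mathcal E(\lambda,A)\cap\mathcal E(\nu,L))$. *)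

(* Defs.v *)
From HB Require Import structures.
From mathcomp Require Import all_boot all_order all_algebra finmap.
From mathcomp Require Import all_classical all_reals all_analysis.

Set Implicit Arguments.
Unset Strict Implicit.
Unset Printing Implicit Defensive.

Import Order.TTheory GRing.Theory Num.Theory.
Import numFieldNormedType.Exports.

Local Open Scope classical_set_scope.
Local Open Scope ring_scope.

(* The definitions are for matrices over a numClosedFieldType C, which carries
   the topology of its norm; they are meant for C = R[i] with R : realType. *)
Section Definitions.
Variables (C : numClosedFieldType) (n : nat).
Implicit Types (X A L : 'M[C]_n) (lambda nu : C).

(* The index i >= 1 of the sequences is shifted to start at 0. *)
Definition root_limits A : set 'M[C]_n :=
  [set L | exists (c : nat -> nat) (B : nat -> 'M[C]_n),
    [/\ forall i, (0 < c i)%N,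
        {homo c : i j / (i < j)%N},
        forall i, B i ^+ c i = A
      & B @ \oo --> L]].

Definition sigma_star X : {fset C} :=
  fset_set [set lambda | eigenvalue X lambda /\ lambda != 0].

(* The set above is finite, so that fset_set does not fall back to fset0. *)
Lemma in_sigma_star X lambda :
  (lambda \in sigma_star X) = eigenvalue X lambda && (lambda != 0).
Proof.
rewrite in_fset_set; last first.
  have [rs char_rs] := closed_field_poly_normal (char_poly X).
  apply: (sub_finite_set _ (finite_seq rs)) => z /= [].
  rewrite eigenvalue_root_char char_rs (monicP (char_poly_monic X)) scale1r.
  by rewrite root_prod_XsubC.
by apply/idP/andP; rewrite inE.
Qed.

Definition mult lambda X : nat := mup lambda (char_poly X).

(* geigenspace is the space of row vectors v with v *m (g - lambda) ^+ n = 0;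
   transposing turns the right generalised eigenspace of X into this form.
   A subspace is represented by a matrix with that row space. *)
Definition gen_eigenspace lambda X : 'M[C]_n := geigenspace X^T lambda.

Definition jordan_block lambda (k : nat) : 'M[C]_k :=
  \matrix_(i, j) (lambda *+ (i == j) + (i.+1 == j :> nat)%:R).

(* The pair (lambda, k) stands for a k x k Jordan block with eigenvalue lambda. *)
Definition jordan_mx (s : seq (C * nat)) :=
  \mxdiag_(i < size s)
     jordan_block (tnth (in_tuple s) i).1 (tnth (in_tuple s) i).2.

(* X is similar to jordan_mx s; the two-sided inverses force the dimension of
   jordan_mx s to be n without having to cast between matrix types. *)
Definition is_jordan_form X (s : seq (C * nat)) : Prop :=
  all (fun b => 0 < b.2)%N s /\
  exists (P : 'M[C]_(n, _)) (Q : 'M[C]_(_, n)),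
    [/\ P *m Q = 1%:M, Q *m P = 1%:M & X = P *m jordan_mx s *m Q].

(* The Jordan form is unique up to the order of its blocks; one order is chosen
   here. Multisets are sequences up to perm_eq. *)
Definition jordan_form X : seq (C * nat) :=
  xget [::] [set s | is_jordan_form X s].

Definition jordan_sizes lambda X : seq nat :=
  [seq b.2 | b <- jordan_form X & b.1 == lambda].

(* Only the entries with lambda in sigma_star A and nu in sigma_star L are
   entries of the multiplicity rearrangement matrix. *)
Definition rearrangement_mx A L lambda nu : nat :=
  \rank (gen_eigenspace lambda A :&: gen_eigenspace nu L)%MS.

(* S is a finite index set; the parts may be empty. *)
Definition multiset_partition (b : seq nat) (S : {fset C})
    (parts : C -> seq nat) : Prop :=
  perm_eq b (flatten [seq parts nu | nu <- S]).

End Definitions.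

(* Main.v *)
Require Import Defs.
From mathcomp Require Import all_boot all_order all_algebra finmap.
From mathcomp Require Import complex zify.
From mathcomp Require Import all_classical all_reals all_analysis.

(** If B_i ^ c_i = A and B_i --> L, then every B_i commutes with A, hence so
    does L, and the generalised eigenspaces of each of A and L are stable under
    the other. Subspaces are represented by row vectors, acted on from the
    right; the statements about column vectors are those for the transposes of
    A, L and the B_i. Everything except the treatment of the eigenvalue 0
    follows from this commutation.

    The eigenvalue 0. On the nilpotent part of A each B_i is nilpotent, so
    B_i ^ n vanishes there, and L ^ n does too ([kermx_pow_root]). On the
    invertible part, that is, the image of A ^ n, let b_i and a be the
    restrictions of B_i and A. Then (det b_i) ^ c_i = det a is a nonzero
    constant, which prevents det b_i from tending to 0: once |det b_i| < 1 we
    have |det a| <= |det b_i| ([eq0_of_roots_cvg0]). So L is invertible there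
    ([kermx_pow_limit]), and A and L have the same generalised eigenspace for
    0. Apart from the passage to the limit in B_i A = A B_i, only this part of
    the proof uses the topology.

    Splitting. Write E for the generalised eigenspace of A at lambda <> 0. A
    subspace V of E that is stable under L is the direct sum of its
    intersections with the generalised eigenspaces of L
    ([sum_cap_geigenspace]); that of 0 contributes nothing, because it is
    disjoint from E. Taking V = E gives the row sums and the inclusions, and
    exchanging A and L gives the columns.

    The Jordan blocks. Let B(lambda, nu) be the block sizes of A restricted to
    the intersection of E with the generalised eigenspace of L at nu. A list of
    block sizes k is determined by the sums of min(k, j) over all j
    ([perm_eq_sum_minn]), and this sum is the dimension of the kernel of
    (A - lambda) ^ j on the space in question. These dimensions add up over nu,
    because the kernel of (A - lambda) ^ j is itself a subspace of E stable
    under L and can be taken for V ([jordan_sizes_partition]).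

    All of this presupposes that a Jordan form exists. A Jordan block is split
    off by means of a chain of row vectors v N^i and a dual chain of column
    vectors N^j w, with N = A - lambda: if v N^k w <> 0 while N ^ (k + 1) kills
    v and w, their Gram matrix is triangular and invertible, and the orthogonal
    of the dual chain is a stable complement of the chain
    ([split_jordan_chain]). *)

Set Implicit Arguments.
Unset Strict Implicit.
Unset Printing Implicit Defensive.

Import Order.TTheory GRing.Theory Num.Theory.
Import numFieldNormedType.Exports.

Local Open Scope ring_scope.

(** * Similarity *)

Section Similarity.
Variable F : fieldType.

(** The dimensions of X and Y may differ syntactically: a Jordan matrix lives in
    a dimension that is a sum, and relating it to a matrix of dimension n
    through P and Q avoids casts. *)
Definition similar_mx m n (X : 'M[F]_m) (Y : 'M[F]_n) : Prop :=
  exists (P : 'M[F]_(m, n)) (Q : 'M[F]_(n, m)),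
    [/\ P *m Q = 1%:M, Q *m P = 1%:M & X = P *m Y *m Q].

Lemma similar_mx_refl m (X : 'M[F]_m) : similar_mx X X.
Proof. by exists 1%:M, 1%:M; rewrite !mulmx1 mul1mx. Qed.

Lemma similar_mx_trans m n p (X : 'M[F]_m) (Y : 'M[F]_n) (Z : 'M[F]_p) :
  similar_mx X Y -> similar_mx Y Z -> similar_mx X Z.
Proof.
move=> [P [Q [PQ QP ->]]] [P' [Q' [PQ' QP' ->]]].
exists (P *m P'), (Q' *m Q); rewrite !mulmxA; split=> //.
  by rewrite -(mulmxA P) PQ' mulmx1.
by rewrite -(mulmxA Q') QP mulmx1.
Qed.

Lemma similar_mx_sym m n (X : 'M[F]_m) (Y : 'M[F]_n) :
  similar_mx X Y -> similar_mx Y X.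
Proof.
move=> [P [Q [PQ QP ->]]]; exists Q, P; split=> //.
by rewrite !mulmxA QP mul1mx -mulmxA QP mulmx1.
Qed.

Lemma similar_mx_dim m n (X : 'M[F]_m) (Y : 'M[F]_n) :
  similar_mx X Y -> m = n.
Proof.
move=> [P [Q [PQ QP _]]]; apply/eqP.
by rewrite eqn_leq (mulmx1_min PQ) (mulmx1_min QP).
Qed.

Lemma similar_mx_cast m n (e : m = n) (X : 'M[F]_m) :
  similar_mx (castmx (e, e) X) X.
Proof. by case: n / e; rewrite castmx_id; exact: similar_mx_refl. Qed.

Lemma similar_mx_block m n p (X : 'M[F]_m) (Y : 'M[F]_n) (Z : 'M[F]_p) :
  similar_mx Y Z -> similar_mx (block_mx X 0 0 Y) (block_mx X 0 0 Z).
Proof.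
move=> [P [Q [PQ QP ->]]]; exists (block_mx 1%:M 0 0 P), (block_mx 1%:M 0 0 Q).
by rewrite !mulmx_block !(mulmx0, mul0mx, addr0, add0r, mulmx1, mul1mx) PQ QP
           -!scalar_mx_block.
Qed.

Lemma similar_mx_pow m n (X : 'M[F]_m) (Y : 'M[F]_n) a j :
  similar_mx X Y -> similar_mx ((X - a%:M) ^+ j) ((Y - a%:M) ^+ j).
Proof.
move=> [P [Q [PQ QP ->]]]; exists P, Q; split=> //.
set Z := P *m Y *m Q - a%:M.
have defZ : Z = P *m (Y - a%:M) *m Q.
  by rewrite mulmxBr mulmxBl mul_mx_scalar -scalemxAl PQ scalemx1.
elim: j => [|j IHj]; first by rewrite !expr0 mulmx1.
rewrite !exprS IHj -!mulmxE defZ !mulmxA; congr (_ *m _ *m _).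
by rewrite -mulmxA QP mulmx1.
Qed.

Lemma similar_mx_rank m n (X : 'M[F]_m) (Y : 'M[F]_n) :
  similar_mx X Y -> \rank X = \rank Y.
Proof.
move=> sXY; apply/eqP; rewrite eqn_leq.
have le_rank k l (Z : 'M[F]_k) (T : 'M[F]_l) :
    similar_mx Z T -> (\rank Z <= \rank T)%N.
  move=> [P [Q [_ _ ->]]].
  by rewrite (leq_trans (mxrankM_maxl _ _)) // mxrankM_maxr.
by rewrite !le_rank //; exact: similar_mx_sym.
Qed.

Lemma char_poly_similar m n (X : 'M[F]_m) (Y : 'M[F]_n) :
  similar_mx X Y -> char_poly X = char_poly Y.
Proof.
move=> sXY; move: (similar_mx_dim sXY) => e; move: sXY; subst n.
move=> [P [Q [PQ _ ->]]].
pose f := map_mx (@polyC F).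
have fPQ : f _ _ P *m f _ _ Q = 1%:M by rewrite -map_mxM PQ map_mx1.
rewrite /char_poly.
have -> : char_poly_mx (P *m Y *m Q) = f _ _ P *m char_poly_mx Y *m f _ _ Q.
  rewrite /char_poly_mx !map_mxM mulmxBr mulmxBl scalar_mxC.
  by rewrite -(mulmxA _ (f _ _ P)) fPQ mulmx1.
by rewrite !det_mulmx mulrAC -det_mulmx fPQ det1 mul1r.
Qed.
End Similarity.

(** * Jordan matrices *)

Section JordanBlocks.
Variable C : numClosedFieldType.
Implicit Types (a lambda : C) (s : seq (C * nat)).

Lemma jordan_mx_cons lambda k s :
  similar_mx (jordan_mx ((lambda, k) :: s))
             (block_mx (jordan_block lambda k) 0 0 (jordan_mx s)).
Proof.
rewrite /jordan_mx mxdiag_recl; apply: (similar_mx_trans (similar_mx_cast _ _)).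
set p := fun i => tnth (in_tuple ((lambda, k) :: s)) (lift ord0 i).
have -> : tnth (in_tuple s) = p.
  by apply/funext=> i; rewrite /p (tnth_nth (lambda, k)) [RHS](tnth_nth (lambda, k)).
exact: similar_mx_refl.
Qed.

Lemma jordan_block0_pow k j :
  jordan_block 0 k ^+ j = \matrix_(i < k, i' < k) ((i + j)%N == i' :> nat)%:R :> 'M[C]_k.
Proof.
elim: j => [|j IHj]; apply/matrixP=> i i'.
  by rewrite expr0 !mxE addn0.
rewrite exprSr IHj !mxE; case: (ltnP (i + j) k) => [lt_k|ge_k].
  rewrite (bigD1 (Ordinal lt_k)) //= big1 => [|l /negPf neq_l].
    by rewrite !mxE eqxx mul1r mul0rn add0r addr0 addnS.
  by rewrite !mxE eq_sym -[_ == _ :> nat]/(l == Ordinal lt_k) neq_l mul0r.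
rewrite big1 => [|l _].
  by rewrite addnS gtn_eqF // ltnS (leq_trans (ltnW (ltn_ord i'))).
by rewrite !mxE gtn_eqF ?mul0r // (leq_trans (ltn_ord l)).
Qed.

Lemma rank_jordan_block_pow a lambda k j :
  \rank ((jordan_block lambda k - a%:M) ^+ j) =
  (if lambda == a then k - j else k)%N.
Proof.
have -> : jordan_block lambda k - a%:M = jordan_block (lambda - a) k.
  apply/matrixP=> i i'; rewrite !mxE mulrnBl addrAC.
  by congr (_ - _ *+ _ + _).
rewrite -subr_eq0; case: eqP => [->|/eqP nz].
  have le_kj : (k - j <= k)%N by exact: leq_subr.
  apply/eqP; rewrite eqn_leq jordan_block0_pow; set J := \matrix_(_, _) _.
  apply/andP; split.
    (* The last j rows of J vanish. *)
    have -> : J = (pid_mx (k - j) : 'M[C]_k) *m J.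
      apply/matrixP=> i i'; rewrite mxE [RHS]mxE (bigD1 i) //= big1 => [|l].
        rewrite !mxE eqxx /= addr0; case: ltnP => [_|le_kj_i]; first by rewrite mul1r.
        rewrite mul0r gtn_eqF // (leq_trans (ltn_ord i')) //.
        by rewrite addnC -leq_subLR.
      by rewrite !mxE val_eqE eq_sym => /negPf ->; rewrite mul0r.
    by rewrite (leq_trans (mxrankM_maxl _ _)) // rank_pid_mx.
  rewrite -[X in (X <= _)%N](@rank_pid_mx C k k) //.
  (* The other rows of J are distinct unit vectors. *)
  have -> : (pid_mx (k - j) : 'M[C]_k) = J *m J^T.
    apply/matrixP=> i i'; rewrite mxE [RHS]mxE.
    have [lt_k|ge_k] := ltnP i (k - j).
      have lt' : (i + j < k)%N by rewrite addnC -ltn_subRL.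
      rewrite (bigD1 (Ordinal lt')) //= big1 => [|l /negPf neq_l].
        by rewrite !mxE eqxx mul1r addr0 eqn_add2r eq_sym andbT.
      by rewrite !mxE eq_sym -[_ == _ :> nat]/(l == Ordinal lt') neq_l mul0r.
    rewrite andbF big1 // => l _.
    by rewrite !mxE gtn_eqF ?mul0r // (leq_trans (ltn_ord l)) // addnC -leq_subLR.
  by rewrite mxrankM_maxl.
apply: mxrank_unit; set J := jordan_block _ _.
have uJ : J \in unitmx.
  rewrite unitmxE -det_tr det_trig.
    rewrite unitfE; apply/prodf_neq0 => i _.
    by rewrite !mxE eqxx (gtn_eqF (ltnSn i)) addr0.
  apply/is_trig_mxP => i i' lt_i.
  by rewrite !mxE -val_eqE (gtn_eqF lt_i) (gtn_eqF (leqW lt_i)) addr0.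
elim: j => [|j IHj]; first by rewrite expr0 unitmx1.
by rewrite exprS -mulmxE unitmx_mul uJ.
Qed.

Lemma char_poly_jordan_block lambda k :
  char_poly (jordan_block lambda k) = ('X - lambda%:P) ^+ k.
Proof.
rewrite /char_poly -det_tr det_trig.
  rewrite (eq_bigr (fun=> 'X - lambda%:P)) ?prodr_const ?card_ord // => i _.
  by rewrite !mxE eqxx (gtn_eqF (ltnSn i)) addr0.
apply/is_trig_mxP => i i' lt_i.
by rewrite !mxE -val_eqE (gtn_eqF lt_i) (gtn_eqF (leqW lt_i)) addr0 subrr.
Qed.

Lemma rank_block_pow (F : fieldType) m n (X : 'M[F]_m) (Y : 'M[F]_n)
    (a : F) j :
  \rank ((block_mx X 0 0 Y - a%:M) ^+ j) =
  (\rank ((X - a%:M) ^+ j) + \rank ((Y - a%:M) ^+ j))%N.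
Proof.
rewrite -rank_diag_block_mx; congr (\rank _).
elim: j => [|j IHj]; first by rewrite !expr0 -scalar_mx_block.
rewrite !exprS IHj -!mulmxE (scalar_mx_block _ _ a) opp_block_mx add_block_mx.
by rewrite mulmx_block !(oppr0, mulmx0, mul0mx, addr0, add0r).
Qed.

Lemma jordan_form_dim n (X : 'M[C]_n) s :
  similar_mx X (jordan_mx s) -> n = sumn [seq b.2 | b <- s].
Proof.
move=> /similar_mx_dim ->.
elim: s => [|[lambda k] s IHs]; first by rewrite big_ord0.
rewrite big_ord_recl /= -IHs; congr (_ + _)%N; apply: eq_bigr => i _.
by rewrite !(tnth_nth (lambda, k)).
Qed.

(** A block of size k contributes min(k, j) to the dimension of the kernel of
    (X - a) ^ j if its eigenvalue is a, and nothing otherwise. *)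
Lemma rank_jordan_form_pow n (X : 'M[C]_n) s a j :
  similar_mx X (jordan_mx s) ->
  (\rank ((X - a%:M) ^+ j) + sumn [seq minn b.2 j | b <- s & b.1 == a])%N = n.
Proof.
move=> sXs; rewrite (similar_mx_rank (similar_mx_pow a j sXs)).
rewrite (jordan_form_dim sXs) {n X sXs}.
elim: s => [|[lambda k] s IHs].
  by rewrite addn0; apply/eqP; rewrite -leqn0 (leq_trans (rank_leq_row _)) // big_ord0.
rewrite (similar_mx_rank (similar_mx_pow a j (jordan_mx_cons lambda k s))).
rewrite rank_block_pow rank_jordan_block_pow /= -IHs.
case: (lambda == a); last by rewrite addnA.
by rewrite /= addnACA minnE subnKC ?leq_subr.
Qed.

Lemma mult_jordan_form n (X : 'M[C]_n) s a :
  similar_mx X (jordan_mx s) ->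
  mult a X = sumn [seq b.2 | b <- s & b.1 == a].
Proof.
rewrite /mult => /char_poly_similar ->; elim: s => [|[lambda k] s IHs].
  rewrite /= mupNroot // /char_poly.
  suff -> : \det (char_poly_mx (jordan_mx ([::] : seq (C * nat)))) = 1 by rewrite root1.
  move: (char_poly_mx _); rewrite /= big_ord0 => M; exact: det_mx00.
rewrite (char_poly_similar (jordan_mx_cons lambda k s)) /char_poly char_block_diag_mx.
rewrite det_ublock -!/(char_poly _) char_poly_jordan_block.
rewrite mupM ?monic_neq0 ?char_poly_monic ?monic_exp ?monicXsubC //.
by rewrite IHs mup_XsubCX /=; case: (lambda == a).
Qed.

End JordanBlocks.

(** * Existence of the Jordan form *)

Section JordanForm.
Variable C : numClosedFieldType.

(** Let q (T - lambda) ^ (k + 1) be the minimal polynomial, with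
    q(lambda) <> 0. It does not divide q (T - lambda) ^ k q, so that polynomial
    in X has a nonzero entry (i, j); v and w are row i and column j of
    q(X). *)
Lemma exists_jordan_chain n (X : 'M[C]_n.+1) :
  exists (lambda : C) (k : nat) (v : 'rV[C]_n.+1) (w : 'cV[C]_n.+1),
  [/\ v *m (X - lambda%:M) ^+ k.+1 = 0, (X - lambda%:M) ^+ k.+1 *m w = 0 &
      v *m (X - lambda%:M) ^+ k *m w != 0].
Proof.
pose p := mxminpoly X.
have [lambda p_lambda] : exists lambda, root p lambda.
  apply/closed_rootP; rewrite size_mxminpoly eqSS -lt0n.
  exact: mxminpoly_nonconstant.
have [m [q]] := multiplicity_XsubC p lambda.
rewrite monic_neq0 ?mxminpoly_monic //= => q_lambda def_p.
case: m => [|k] in def_p.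
  by rewrite def_p mulr1 (negPf q_lambda) in p_lambda.
pose f := horner_mx X; pose l := 'X - lambda%:P.
have fl j : (X - lambda%:M) ^+ j = f (l ^+ j).
  by rewrite /f rmorphXn /= rmorphB /= horner_mx_X horner_mx_C.
have q_neq0 : q != 0 by apply: contraNneq q_lambda => ->; rewrite root0.
have nz : f (q * l ^+ k * q) != 0.
  apply: contra q_lambda; rewrite -dvd_mxminpoly -/p {1}def_p exprSr mulrA.
  by rewrite dvdp_mul2l ?dvdp_XsubCl // mulf_neq0 ?expf_neq0 ?polyXsubC_eq0 //.
have kill : f q *m f (l ^+ k.+1) = 0.
  by rewrite mulmxE -rmorphM -def_p; exact: mx_root_minpoly.
have [i [j nz_ij]] : exists i j, f (q * l ^+ k * q) i j != 0.
  apply/existsPP; first by move=> i; apply: existsP.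
  apply: contraNT nz => /existsPn Z0; apply/eqP/matrixP=> i j; apply/eqP.
  by rewrite mxE; have /existsPn/(_ j)/negbNE := Z0 i.
exists lambda, k, (row i (f q)), (col j (f q)).
rewrite !fl; split.
- by rewrite -row_mul kill row0.
- have kill' : f (l ^+ k.+1) *m f q = 0.
    by rewrite mulmxE -rmorphM mulrC rmorphM -mulmxE.
  by rewrite colE mulmxA kill' mul0mx.
apply: contra nz_ij => /eqP; rewrite colE mulmxA -!row_mul -colE.
have -> : f q *m f (l ^+ k) *m f q = f (q * l ^+ k * q).
  by rewrite !mulmxE -!rmorphM.
by move=> /matrixP/(_ 0 0); rewrite !mxE => ->.
Qed.

(** The span of the v N^i is complemented by the space of row vectors
    orthogonal to all N^j w; both are stable under X, as N ^ (k + 1) kills v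
    and w. *)
Lemma split_jordan_chain n (X : 'M[C]_n) lambda k
    (v : 'rV[C]_n) (w : 'cV[C]_n) (N := X - lambda%:M) :
    v *m N ^+ k.+1 = 0 -> N ^+ k.+1 *m w = 0 -> v *m N ^+ k *m w != 0 ->
  exists (m : nat) (Y : 'M[C]_m), (m < n)%N /\
    similar_mx X (block_mx (jordan_block lambda k.+1) 0 0 Y).
Proof.
move=> vN Nw vNw.
pose J0 : 'M[C]_k.+1 := jordan_block 0 k.+1.
have NX : X = N + lambda%:M by rewrite subrK.
have defJ : jordan_block lambda k.+1 = J0 + lambda%:M.
  by apply/matrixP=> i j; rewrite !mxE mul0rn add0r addrC.
pose U : 'M[C]_(k.+1, n) := \matrix_(i < k.+1) (v *m N ^+ i).
(* The dual chain is taken in reverse order so that the Gram matrix U *m W is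
   triangular, with the constant v N^k w on the diagonal. *)
pose W : 'M[C]_(n, k.+1) := \matrix_(i, j) (N ^+ (k - j) *m w) i 0.
have rowU i : row i U = v *m N ^+ i by rewrite rowK.
have colW j : col j W = N ^+ (k - j) *m w.
  by apply/matrixP=> i i'; rewrite ord1 2![in LHS]mxE.
have NU : U *m X = jordan_block lambda k.+1 *m U.
  rewrite NX defJ mulmxDr mulmxDl scalar_mxC; congr (_ + _).
  apply/row_matrixP=> i; rewrite !row_mul rowU -mulmxA mulmxE -exprSr.
  have [lt_ik|ge_ik] := ltnP i.+1 k.+1.
    have -> : row i J0 = delta_mx 0 (Ordinal lt_ik).
      by apply/rowP=> j; rewrite !mxE mul0rn add0r eqxx /= eq_sym.
    by rewrite -rowE rowU.
  have -> : row i J0 = 0.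
    by apply/rowP=> j; rewrite !mxE mul0rn add0r gtn_eqF // (leq_trans (ltn_ord j)).
  have -> : i = k :> nat by apply/eqP; rewrite eqn_leq (ge_ik : (k <= i)%N) andbT -ltnS.
  by rewrite mul0mx.
have NW : X *m W = W *m jordan_block lambda k.+1.
  rewrite NX defJ mulmxDr mulmxDl scalar_mxC; congr (_ + _).
  apply: trmx_inj; apply/row_matrixP=> j.
  rewrite -!tr_col; congr (_^T).
  rewrite colE -mulmxA -colE colW mulmxA mulmxE -exprS [in RHS]colE -mulmxA -colE.
  case: j => [[|j] lt_j].
    have -> : col (Ordinal lt_j) J0 = 0.
      by apply/colP=> i; rewrite !mxE mul0rn add0r.
    by rewrite mulmx0 subn0.
  have -> : col (Ordinal lt_j) J0 = delta_mx (Ordinal (ltnW lt_j)) 0.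
    by apply/colP=> i; rewrite !mxE mul0rn add0r eqxx andbT.
  by rewrite -colE colW /= subnSK.
have UW_entry i j : (U *m W) i j = (v *m N ^+ (i + (k - j)) *m w) 0 0.
  transitivity ((row i U *m col j W) 0 0).
    by rewrite colE mulmxA -row_mul -colE 2![in RHS]mxE.
  by rewrite rowU colW !mulmxA -(mulmxA v) mulmxE -exprD.
have uUW : U *m W \in unitmx.
  rewrite unitmxE -det_tr det_trig.
    rewrite unitfE; apply/prodf_neq0 => i _; rewrite mxE UW_entry.
    rewrite subnKC ?(ltn_ord i : (i <= k)%N) //; apply: contra vNw => /eqP e.
    by apply/eqP/matrixP=> ? ?; rewrite !ord1 e mxE.
  apply/is_trig_mxP=> i j lt_ij; rewrite mxE UW_entry.
  have -> : (j + (k - i) = k.+1 + (j - i.+1))%N.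
    by have := ltn_ord i; have := ltn_ord j; lia.
  by rewrite exprD -mulmxE mulmxA vN !mul0mx mxE.
(* E *m U is the projector on the span of the chain along the orthogonal of
   the dual chain, of which K is a basis. *)
pose E := W *m invmx (U *m W).
have UE : U *m E = 1%:M by rewrite mulmxA mulmxV.
pose K := row_base (kermx W).
have KW : K *m W = 0 by apply/sub_kermxP; rewrite eq_row_base.
have KE : K *m E = 0 by rewrite mulmxA KW mul0mx.
pose G := (1%:M - E *m U) *m pinvmx K.
have GK : G *m K = 1%:M - E *m U.
  rewrite mulmxKpV // eq_row_base; apply/sub_kermxP.
  by rewrite mulmxBl mul1mx -!mulmxA mulVmx // mulmx1 subrr.
exists (\rank (kermx W)), (K *m X *m pinvmx K); split.
  rewrite mxrank_ker -subn_gt0 subKn ?rank_leq_row //.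
  rewrite (leq_trans _ (mxrankM_maxr U W)) //.
  by rewrite mxrank_unit.
have KX : K *m X *m pinvmx K *m K = K *m X.
  rewrite mulmxKpV // eq_row_base; apply/sub_kermxP.
  by rewrite -mulmxA NW mulmxA KW mul0mx.
apply: similar_mx_sym.
exists (col_mx U K), (row_mx E G).
have QP : col_mx U K *m row_mx E G = 1%:M.
  have UG : U *m G = 0 by rewrite mulmxA mulmxBr mulmx1 (mulmxA U E) UE mul1mx subrr mul0mx.
  have KG : K *m G = 1%:M.
    by rewrite mulmxA mulmxBr mulmx1 (mulmxA K E) KE mul0mx subr0 mulmxVp ?row_base_free.
  by rewrite mul_col_row UE KE UG KG -scalar_mx_block.
have QX : col_mx U K *m X =
    block_mx (jordan_block lambda k.+1) 0 0 (K *m X *m pinvmx K) *m col_mx U K.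
  by rewrite mul_col_mx mul_block_col !mul0mx addr0 add0r NU KX.
split=> //; first by rewrite mul_row_col GK addrC subrK.
by rewrite QX -(mulmxA _ (col_mx U K)) QP mulmx1.
Qed.

Theorem jordan_form_exists n (X : 'M[C]_n) : exists s, is_jordan_form X s.
Proof.
elim/ltn_ind: n X => -[_ X|n IHn X].
  exists [::]; split=> //.
  have sim0 m (Y : 'M[C]_m) : m = 0%N -> similar_mx X Y.
    move=> m0; move: Y; rewrite m0 => Y; exists 0, 0.
    by split; apply/matrixP => -[].
  by apply: sim0; rewrite big_ord0.
have [lambda [k [v [w [vN Nw vNw]]]]] := exists_jordan_chain X.
have [m [Y [lt_m sXY]]] := split_jordan_chain vN Nw vNw.
have [s [s_gt0 sY]] := IHn m lt_m Y.
exists ((lambda, k.+1) :: s); split=> //.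
apply: (similar_mx_trans sXY); apply: similar_mx_trans (similar_mx_block _ sY) _.
exact/similar_mx_sym/jordan_mx_cons.
Qed.

Lemma jordan_formP n (X : 'M[C]_n) : is_jordan_form X (jordan_form X).
Proof.
have [s sX] := jordan_form_exists X.
by apply: (@xgetPex _ [::] [set t | is_jordan_form X t]%classic); exists s.
Qed.

End JordanForm.

(** * Recovering a multiset from truncated sums *)

Lemma count_gt_minn (s : seq nat) j :
  (sumn [seq minn k j.+1 | k <- s] =
   sumn [seq minn k j | k <- s] + count (fun k => j < k) s)%N.
Proof.
elim: s => //= k s ->; rewrite addnACA; congr (_ + _)%N.
by case: ltnP; lia.
Qed.

(** The first differences in j of the sums of min(k, j) count the k > j, and the
    second differences count the k = j + 1. *)
Lemma perm_eq_sum_minn (s t : seq nat) :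
    all (fun k => 0 < k)%N s -> all (fun k => 0 < k)%N t ->
    (forall j, sumn [seq minn k j | k <- s] = sumn [seq minn k j | k <- t]) ->
  perm_eq s t.
Proof.
move=> s_gt0 t_gt0 eq_st.
have eq_count j : (count (fun k => j < k) s = count (fun k => j < k) t)%N.
  by have := eq_st j.+1; rewrite !count_gt_minn eq_st => /addnI.
have count_split j r :
    (count (fun k => j < k) r =
     count_mem j.+1 r + count (fun k => j.+1 < k) r)%N.
  by elim: r => //= k r ->; case: (ltngtP j.+1 k); lia.
apply/allP=> -[|j] _ /=; apply/eqP; last first.
  apply/eqP; rewrite -(eqn_add2r (count (fun k => j.+1 < k) s)%N) -count_split eq_count.
  by rewrite count_split eq_count.
have no0 r : all (fun k => 0 < k)%N r -> count_mem 0%N r = 0%N.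
  move=> /allP r_gt0; apply/eqP; rewrite -leqn0 leqNgt -has_count.
  by apply/hasPn=> k /r_gt0; case: k.
by rewrite !no0.
Qed.

(** * Decomposition of stable subspaces *)

Section SeqSums.
Variables (F : fieldType) (n : nat) (T : eqType).
Implicit Types (S : seq T) (P : pred T) (f : T -> 'M[F]_n).

Lemma sumsmx_seq_sup x S P f : x \in S -> P x ->
  (f x <= \sum_(y <- S | P y) f y)%MS.
Proof.
move=> xS Px; rewrite (big_rem x xS) Px /=; exact: addsmxSl.
Qed.

Lemma sumsmx_seq_sub S P f m (V : 'M[F]_(m, n)) :
  (forall x, x \in S -> P x -> (f x <= V)%MS) ->
  (\sum_(y <- S | P y) f y <= V)%MS.
Proof.
move=> fV; rewrite big_seq_cond; apply: (big_rec (fun W => W <= V)%MS); first exact: sub0mx.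
by move=> x W /andP[xS Px] WV; rewrite addsmx_sub fV.
Qed.
End SeqSums.

Section Decomposition.
Variable C : numClosedFieldType.

(** The exponent n + 1 bounds all multiplicities in the characteristic
    polynomial and is the one that defines generalised eigenspaces. *)
Lemma annihilating_poly n (Y : 'M[C]_n.+1) :
  exists2 T : seq C, uniq T /\ (forall nu, nu \in T -> eigenvalue Y nu) &
    (kermxpoly Y (\prod_(nu <- T) ('X - nu%:P) ^+ n.+1) :=: 1%:M)%MS.
Proof.
have [rs char_rs] := closed_field_poly_normal (char_poly Y).
rewrite (monicP (char_poly_monic Y)) scale1r in char_rs.
exists (undup rs).
  split=> [|nu]; first exact: undup_uniq.
  by rewrite mem_undup eigenvalue_root_char char_rs root_prod_XsubC.
apply: kermxpoly_min; apply: dvdp_trans (mxminpoly_dvd_char Y) _.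
have size_rs : size rs = n.+1.
  by apply: succn_inj; rewrite -(size_char_poly Y) char_rs size_prod_XsubC.
rewrite char_rs -prodr_undup_exp_count; apply: (big_ind2 (fun p q => p %| q)).
- exact: dvdpp.
- by move=> *; exact: dvdp_mul.
by move=> nu _; rewrite dvdp_exp2l // -size_rs count_size.
Qed.

(** The restriction of Y to V is annihilated by the same polynomial as Y, so V
    is the sum of the kernels of its coprime factors; these kernels are the
    intersections of V with the generalised eigenspaces of Y. The hypothesis
    on S allows the eigenvalues that do not occur on V to be left out. *)
Lemma sum_cap_geigenspace n (Y V : 'M[C]_n.+1) (S : seq C) :
    stablemx V Y -> uniq S ->
    (forall nu, eigenvalue Y nu -> nu \notin S ->
       (V :&: geigenspace Y nu = 0)%MS) ->
  (V <= \sum_(nu <- S) (V :&: geigenspace Y nu))%MS /\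
  (\sum_(nu <- S) \rank (V :&: geigenspace Y nu)%MS)%N = \rank V.
Proof.
move=> VY uniqS notS.
have VS : (V <= \sum_(nu <- S) (V :&: geigenspace Y nu))%MS.
  have [T [uniqT eigT] kerT] := annihilating_poly Y.
  set K := row_base V.
  have KY : stablemx K Y by rewrite stablemx_row_base.
  have K_free : row_free K := row_base_free V.
  pose q i := ('X - (tnth (in_tuple T) i)%:P) ^+ n.+1 : {poly C}.
  have coq : forall i j : 'I_(size T), i != j -> coprimep (q i) (q j).
    move=> i j neq_ij; rewrite coprimep_expr ?coprimep_expl// coprimep_XsubC root_XsubC.
    by rewrite (inj_eq (tuple_uniqP (in_tuple T) uniqT)) eq_sym.
  have fullZ : (1%:M <= \sum_i kermxpoly (conjmx K Y) (q i))%MS.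
    rewrite -kermxpoly_prod; last first.
      by move=> i j _ _ neq_ji; rewrite coprimep_sym; exact: coq.
    rewrite sub_kermxpoly_conjmx // -(big_tnth _ _ T predT (fun nu => ('X - nu%:P) ^+ n.+1)).
    by rewrite kerT submx1.
  rewrite -(eq_row_base V) -/K -[K]mul1mx.
  apply: submx_trans (submxMr K fullZ) _.
  rewrite sumsmxMr_gen; apply/sumsmx_subP=> i _; rewrite genmxE.
  set nu := tnth (in_tuple T) i.
  have sub_nu : (kermxpoly (conjmx K Y) (q i) *m K <= V :&: geigenspace Y nu)%MS.
    rewrite sub_capmx; apply/andP; split.
      by apply: submx_trans (submxMl _ _) _; rewrite eq_row_base.
    by rewrite -sub_kermxpoly_conjmx.
  have [nuS|nuS] := boolP (nu \in S).
    exact: submx_trans sub_nu (sumsmx_seq_sup _ nuS _).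
  rewrite notS // in sub_nu; last exact/eigT/mem_tnth.
  by apply: submx_trans sub_nu (sub0mx _ _).
split=> //.
have eqV : (V == \sum_(nu <- S) (V :&: geigenspace Y nu))%MS.
  by rewrite VS; apply: sumsmx_seq_sub => nu _ _; exact: capmxSl.
rewrite [RHS](eqmxP eqV) [LHS]big_tnth [in RHS]big_tnth.
apply/esym/mxdirectP/mxdirect_sumsP => i _.
have direct := @mxdirect_sum_geigenspace C _ _ Y predT (tnth (in_tuple S))
                 (fun i j _ _ => tuple_uniqP (in_tuple S) uniqS i j).
move/mxdirect_sumsP/(_ i isT): direct => d0; apply/eqP; rewrite -submx0 -[X in (_ <= X)%MS]d0.
apply: capmxS; first exact: capmxSr.
by apply/sumsmx_subP=> j neq_ji; rewrite (sumsmx_sup j) ?capmxSr.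
Qed.
End Decomposition.

(** * Block sizes as kernel dimensions *)

Section JordanSizes.
Variable C : numClosedFieldType.

Lemma jordan_sizes_gt0 n (X : 'M[C]_n) lambda :
  all (fun k => 0 < k)%N (jordan_sizes lambda X).
Proof.
have [s_gt0 _] := jordan_formP X; apply/allP=> _ /mapP[b + ->].
by rewrite mem_filter => /andP[_ /(allP s_gt0)].
Qed.

Lemma sum_minn_jordan_sizes n (X : 'M[C]_n) lambda j :
  (\rank ((X - lambda%:M) ^+ j) +
   sumn [seq minn k j | k <- jordan_sizes lambda X])%N = n.
Proof.
have [_ sX] := jordan_formP X; rewrite -[RHS](rank_jordan_form_pow lambda j sX).
by rewrite /jordan_sizes -map_comp.
Qed.

Lemma mult_sum_jordan_sizes n (X : 'M[C]_n) lambda :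
  mult lambda X = sumn (jordan_sizes lambda X).
Proof. by have [_ sX] := jordan_formP X; exact: mult_jordan_form. Qed.

Lemma leq_sumn_mem (s : seq nat) k : k \in s -> (k <= sumn s)%N.
Proof.
by move=> ks; rewrite sumnE (big_rem k ks) leq_addr.
Qed.

Lemma jordan_sizes_leq n (X : 'M[C]_n) lambda k :
  k \in jordan_sizes lambda X -> (k <= n)%N.
Proof.
have [_ sX] := jordan_formP X; rewrite [in (_ <= n)%N](jordan_form_dim sX).
move=> /mapP[b]; rewrite mem_filter => /andP[_ bs] ->.
by apply: leq_sumn_mem; exact: map_f.
Qed.

Lemma map_minn_jordan_sizes n (X : 'M[C]_n) lambda j : (n <= j)%N ->
  [seq minn k j | k <- jordan_sizes lambda X] = jordan_sizes lambda X.
Proof.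
move=> le_nj; apply: map_id_in => k /jordan_sizes_leq le_kn.
by apply/minn_idPl/(leq_trans le_kn).
Qed.

(** No block is larger than n, so the kernels of (X - lambda) ^ j stop growing
    at j = n. *)
Lemma kermx_pow_sub n (X : 'M[C]_n) lambda j :
  (kermx ((X - lambda%:M) ^+ j) <= kermx ((X - lambda%:M) ^+ n))%MS.
Proof.
have ker_mono i l : (i <= l)%N ->
    (kermx ((X - lambda%:M) ^+ i) <= kermx ((X - lambda%:M) ^+ l))%MS.
  move=> /subnKC <-; apply/sub_kermxP.
  by rewrite exprD -mulmxE mulmxA mulmx_ker mul0mx.
have [/ker_mono //|/ltnW le_nj] := leqP j n.
have eq_rank : \rank ((X - lambda%:M) ^+ j) = \rank ((X - lambda%:M) ^+ n).
  have := sum_minn_jordan_sizes X lambda j.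
  rewrite -[RHS](sum_minn_jordan_sizes X lambda n) !map_minn_jordan_sizes //.
  exact: addIn.
by rewrite -(mxrank_leqif_sup (ker_mono _ _ le_nj)) !mxrank_ker eq_rank.
Qed.

Lemma trmx_pow (R : comNzRingType) n (X : 'M[R]_n) j : (X ^+ j)^T = X^T ^+ j.
Proof.
elim: j => [|j IHj]; first by rewrite !expr0 trmx1.
by rewrite exprS exprSr -!mulmxE trmx_mul IHj.
Qed.

Lemma trmx_sub_pow (R : comNzRingType) n (X : 'M[R]_n) lambda j :
  (X^T - lambda%:M) ^+ j = ((X - lambda%:M) ^+ j)^T.
Proof. by rewrite trmx_pow linearB /= tr_scalar_mx. Qed.

Lemma char_poly_trmx (R : comNzRingType) n (X : 'M[R]_n) : char_poly X^T = char_poly X.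
Proof.
by rewrite /char_poly -det_tr /char_poly_mx linearB /= tr_scalar_mx map_trmx trmxK.
Qed.

Lemma rank_gen_eigenspace n (X : 'M[C]_n.+1) lambda :
  \rank (gen_eigenspace lambda X) = mult lambda X.
Proof.
rewrite /gen_eigenspace geigenspaceE mxrank_ker trmx_sub_pow mxrank_tr.
have := sum_minn_jordan_sizes X lambda n.+1.
rewrite map_minn_jordan_sizes // -mult_sum_jordan_sizes => {1}<-.
by rewrite addKn.
Qed.

Lemma restrictmx_sub_pow (F : fieldType) n (X V : 'M[F]_n) lambda j :
  stablemx V X ->
  (conjmx (row_base V) X - lambda%:M) ^+ j *m row_base V =
  row_base V *m (X - lambda%:M) ^+ j.
Proof.
move=> VX; elim: j => [|j IHj]; first by rewrite !expr0 mul1mx mulmx1.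
rewrite exprSr exprS -!mulmxE -mulmxA mulmxBl mulmxKpV ?stablemx_row_base //.
rewrite mul_scalar_mx -mul_mx_scalar -mulmxBr (mulmxA _ (row_base V)) IHj -!mulmxA.
by congr (_ *m _); rewrite !mulmxE -exprSr -exprS.
Qed.

(** The kernel of a power of the restriction of X - lambda to V is the
    intersection of V with the kernel of that power. *)
Lemma sum_minn_jordan_sizes_restrict n (X V : 'M[C]_n) lambda j :
  stablemx V X ->
  sumn [seq minn k j | k <- jordan_sizes lambda (conjmx (row_base V) X)] =
  \rank (V :&: kermx ((X - lambda%:M) ^+ j)).
Proof.
move=> VX; set Z := conjmx (row_base V) X.
apply/eqP; rewrite -(eqn_add2l (\rank ((Z - lambda%:M) ^+ j))).
rewrite sum_minn_jordan_sizes -(mxrankMfree _ (row_base_free V)) restrictmx_sub_pow //.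
by rewrite (eqmxMr _ (eq_row_base V)) mxrank_mul_ker.
Qed.
End JordanSizes.

(** * Commuting matrices with a common nilpotent part *)

Section CommutingPair.
Variables (C : numClosedFieldType) (n : nat) (A L : 'M[C]_n.+1).
Hypothesis AL : comm_mx A L.
Hypothesis ker_AL : (gen_eigenspace 0 A == gen_eigenspace 0 L)%MS.

Lemma tr_comm : comm_mx A^T L^T.
Proof. by rewrite /comm_mx -!trmx_mul AL. Qed.

Lemma cap_gen_eigenspace lambda nu m (X : 'M[C]_m) :
  lambda != nu -> (gen_eigenspace lambda X :&: gen_eigenspace nu X = 0)%MS.
Proof.
move=> neq; apply: mxdirect_kermxpoly.
by rewrite coprimep_expr ?coprimep_expl // coprimep_XsubC root_XsubC eq_sym.
Qed.

(** V does not meet the generalised eigenspace of L at 0, which is that of A,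
    so the nonzero eigenvalues of L suffice. *)
Lemma split_sub_gen_eigenspace lambda (V : 'M[C]_n.+1) :
    lambda != 0 -> (V <= gen_eigenspace lambda A)%MS -> stablemx V L^T ->
  (V <= \sum_(nu <- sigma_star L) (V :&: gen_eigenspace nu L))%MS /\
  (\sum_(nu <- sigma_star L) \rank (V :&: gen_eigenspace nu L)%MS)%N = \rank V.
Proof.
move=> nz VA VL; apply: sum_cap_geigenspace => // [|nu eig_nu].
  exact: fset_uniq.
rewrite in_sigma_star.
have -> : eigenvalue L nu.
  by move: eig_nu; rewrite !eigenvalue_root_char char_poly_trmx.
rewrite negbK => /eqP ->; apply/eqP; rewrite -submx0.
rewrite -(cap_gen_eigenspace A nz) sub_capmx.
by rewrite (submx_trans (capmxSl _ _) VA) (eqmxP ker_AL) capmxSr.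
Qed.

Lemma gen_eigenspace_stable lambda : stablemx (gen_eigenspace lambda A) L^T.
Proof. exact/comm_mx_stable_geigenspace/tr_comm. Qed.

(** Both multisets have the same sums of min(k, j): on the left the dimension of
    the kernel of (A - lambda) ^ j, on the right the sum of the dimensions of
    its intersections with the generalised eigenspaces of L. *)
Lemma jordan_sizes_partition lambda : lambda != 0 ->
  let parts nu := jordan_sizes lambda
    (conjmx (row_base (gen_eigenspace lambda A :&: gen_eigenspace nu L)%MS) A^T) in
  multiset_partition (jordan_sizes lambda A) (sigma_star L) parts /\
  (forall nu, rearrangement_mx A L lambda nu = sumn (parts nu)).
Proof.
move=> nz parts; set E := gen_eigenspace lambda A.
pose N := A^T - lambda%:M.
have kerE j : (kermx (N ^+ j) <= E)%MS.
  by rewrite /E /gen_eigenspace geigenspaceE; exact: kermx_pow_sub.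
have sum_parts nu j : sumn [seq minn k j | k <- parts nu] =
    \rank ((E :&: gen_eigenspace nu L) :&: kermx (N ^+ j)).
  apply: sum_minn_jordan_sizes_restrict.
  rewrite sub_capmx; apply/andP; split.
    apply: submx_trans (submxMr _ (capmxSl _ _)) _.
    exact: comm_mx_stable_geigenspace.
  apply: submx_trans (submxMr _ (capmxSr _ _)) _.
  exact/comm_mx_stable_geigenspace/comm_mx_sym/tr_comm.
split; last first.
  move=> nu; rewrite -[parts nu](@map_minn_jordan_sizes _ _ _ _ n.+1) ?rank_leq_row //.
  rewrite sum_parts; apply: eqmx_rank; apply/andP; split; last exact: capmxSl.
  rewrite sub_capmx submx_refl /=.
  by apply: submx_trans (capmxSl _ _) _; rewrite /E /gen_eigenspace geigenspaceE.
apply: perm_eq_sum_minn; first exact: jordan_sizes_gt0.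
  apply/allP=> k /flattenP[_ /mapP[nu _ ->]]; exact/allP/jordan_sizes_gt0.
move=> j; rewrite [in RHS]map_flatten [in RHS]sumn_flatten -[in RHS]map_comp -[in RHS]map_comp.
rewrite [in RHS]sumnE [in RHS]big_map.
have kerN_L : stablemx (kermx (N ^+ j)) L^T.
  apply/comm_mx_stable_ker/comm_mx_sym; rewrite comm_mxE; apply: commrX.
  by rewrite -comm_mxE; apply: comm_mxB (comm_mx_scalar _ _); exact/comm_mx_sym/tr_comm.
have [_ sum_ker] := split_sub_gen_eigenspace nz (kerE j) kerN_L.
rewrite (eq_bigr (fun nu => \rank (kermx (N ^+ j) :&: gen_eigenspace nu L)%MS)); last first.
  move=> nu _; rewrite /= sum_parts; apply: eqmx_rank; apply/andP; split.
    by rewrite capmxC capmxS ?capmxSr.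
  rewrite !sub_capmx capmxSl capmxSr !andbT.
  exact: submx_trans (capmxSl _ _) (kerE j).
rewrite sum_ker; apply/eqP; rewrite -(eqn_add2l (\rank ((A - lambda%:M) ^+ j))).
rewrite sum_minn_jordan_sizes mxrank_ker /N trmx_sub_pow mxrank_tr.
by rewrite subnKC ?rank_leq_row.
Qed.

(** With m as a variable, the lemma applies to the columns of the rearrangement
    matrix as well as to its rows. In the case of equality, the generalised
    eigenspace of L at nu has the dimension of its intersection with that of A
    at lambda, and so is contained in it. *)
Lemma gen_eigenspace_sub lambda (m : C -> nat) : lambda != 0 ->
    (forall nu, m nu = rearrangement_mx A L lambda nu) ->
  (gen_eigenspace lambda A <=
     \sum_(nu <- sigma_star L | m nu != 0%N) gen_eigenspace nu L)%MS /\
  ((forall nu, nu \in sigma_star L -> m nu != 0%N -> mult nu L = m nu) ->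
   (gen_eigenspace lambda A ==
     \sum_(nu <- sigma_star L | m nu != 0%N) gen_eigenspace nu L)%MS).
Proof.
move=> nz mE; set S := (\sum_(nu <- _ | _) _)%MS.
have sub_S : (gen_eigenspace lambda A <= S)%MS.
  have [dec _] := split_sub_gen_eigenspace nz (submx_refl _) (gen_eigenspace_stable lambda).
  apply: submx_trans dec _; apply: sumsmx_seq_sub => nu nuS _.
  have [m0|nz_m] := eqVneq (m nu) 0%N.
    by move/eqP: m0; rewrite mE mxrank_eq0 => /eqP ->; exact: sub0mx.
  apply: submx_trans (capmxSr _ _) _.
  exact: (@sumsmx_seq_sup _ _ _ nu _ (fun mu => m mu != 0%N)
           (fun mu => gen_eigenspace mu L) nuS nz_m).
split=> // multM; rewrite sub_S; apply: sumsmx_seq_sub => nu nuS nz_m.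
apply: submx_trans (capmxSl _ (gen_eigenspace nu L)).
by rewrite -(mxrank_leqif_sup (capmxSr _ _)) rank_gen_eigenspace multM // mE.
Qed.
End CommutingPair.

(** * Entrywise limits of matrices *)

Section Limits.
Variable C : numClosedFieldType.

(** Otherwise |x i| < 1 and |x i| < |a| for some i, and then
    |a| = |x i| ^ c i <= |x i|. *)
Lemma eq0_of_roots_cvg0 (x : nat -> C) (c : nat -> nat) a :
    (forall i, 0 < c i)%N -> (forall i, x i ^+ c i = a) ->
    (x @ \oo --> (0 : C))%classic ->
  a = 0.
Proof.
move=> c_gt0 xc x0; apply: contraTeq isT => nz_a /=.
have [i [lt1 lta]] : exists i, `|x i| < 1 /\ `|x i| < `|a|.
  apply: (@filter_ex _ \oo%classic); apply: filterI.
    exact: (cvgr0_norm_lt _ x0).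
  by apply: (cvgr0_norm_lt _ x0); rewrite normr_gt0.
have : `|a| <= `|x i|.
  rewrite -(xc i) normrX -[leRHS]expr1.
  exact: (ler_wiXn2l (normr_ge0 _) (ltW lt1) (c_gt0 i)).
by rewrite (lt_geF lta).
Qed.

(** Convergence entry by entry is all that is needed to pass to the limit in
    polynomial expressions of the entries, such as products and
    determinants. *)
Definition mx_cvg m n (B : nat -> 'M[C]_(m, n)) (L : 'M[C]_(m, n)) : Prop :=
  forall i j, ((fun k => B k i j) @ \oo --> L i j)%classic.

Lemma mx_cvg_of_cvg m n (B : nat -> 'M[C]_(m, n)) L :
  (B @ \oo --> L)%classic -> mx_cvg B L.
Proof.
move=> BL i j; apply: (cvg_comp B (fun M : 'M[C]_(m, n) => M i j) BL).
exact: coord_continuous.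
Qed.

Lemma mx_cvg_cst m n (L : 'M[C]_(m, n)) : mx_cvg (fun=> L) L.
Proof. by move=> i j; exact: cvg_cst. Qed.

Lemma mx_cvg_tr m n (B : nat -> 'M[C]_(m, n)) L :
  mx_cvg B L -> mx_cvg (fun k => (B k)^T) L^T.
Proof.
by move=> BL i j; rewrite mxE; under eq_fun do rewrite mxE; exact: BL.
Qed.

Lemma cvg_bigsum (I : Type) (r : seq I) (f : I -> nat -> C) (l : I -> C) :
  (forall i, (f i @ \oo --> l i)%classic) ->
  ((fun k => \sum_(i <- r) f i k) @ \oo --> \sum_(i <- r) l i)%classic.
Proof.
move=> fl; elim: r => [|i r IHr].
  by rewrite big_nil; under eq_fun do rewrite big_nil; exact: cvg_cst.
by rewrite big_cons; under eq_fun do rewrite big_cons; exact: cvgD.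
Qed.

Lemma cvg_bigprod (I : Type) (r : seq I) (f : I -> nat -> C) (l : I -> C) :
  (forall i, (f i @ \oo --> l i)%classic) ->
  ((fun k => \prod_(i <- r) f i k) @ \oo --> \prod_(i <- r) l i)%classic.
Proof.
move=> fl; elim: r => [|i r IHr].
  by rewrite big_nil; under eq_fun do rewrite big_nil; exact: cvg_cst.
by rewrite big_cons; under eq_fun do rewrite big_cons; exact: cvgM.
Qed.

Lemma mx_cvg_mul m n p (B : nat -> 'M[C]_(m, n)) (D : nat -> 'M[C]_(n, p)) L K :
  mx_cvg B L -> mx_cvg D K -> mx_cvg (fun k => B k *m D k) (L *m K).
Proof.
move=> BL DK i j; rewrite mxE; under eq_fun do rewrite mxE.
by apply: cvg_bigsum => l; exact: cvgM.
Qed.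

Lemma mx_cvg_exp n (B : nat -> 'M[C]_n) L j :
  mx_cvg B L -> mx_cvg (fun k => B k ^+ j) (L ^+ j).
Proof.
move=> BL; elim: j => [|j IHj]; first exact: mx_cvg_cst.
rewrite exprS; under [X in mx_cvg X]eq_fun do rewrite exprS.
exact: mx_cvg_mul.
Qed.

Lemma mx_cvg_det n (B : nat -> 'M[C]_n) L :
  mx_cvg B L -> ((fun k => \det (B k)) @ \oo --> \det L)%classic.
Proof.
move=> BL; apply: cvg_bigsum => s; apply: cvgM; first exact: cvg_cst.
by apply: cvg_bigprod => i; exact: BL.
Qed.

Lemma mx_cvg_unique m n (B : nat -> 'M[C]_(m, n)) L K :
  mx_cvg B L -> mx_cvg B K -> L = K.
Proof.
move=> BL BK; apply/matrixP=> i j.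
exact: (cvg_unique (@norm_hausdorff _ _) (BL i j) (BK i j)).
Qed.
End Limits.
Arguments mx_cvg_cst {C m n} L i j.

(** * Limits of roots of a matrix *)

Section RootLimits.
Variable C : numClosedFieldType.

Lemma det_pow (R : comNzRingType) n (X : 'M[R]_n) j : \det (X ^+ j) = \det X ^+ j.
Proof.
elim: j => [|j IHj]; first by rewrite !expr0 det1.
by rewrite !exprS -mulmxE det_mulmx IHj.
Qed.

Variables (n : nat) (A L : 'M[C]_n.+1) (c : nat -> nat) (B : nat -> 'M[C]_n.+1).
Hypothesis c_gt0 : forall i, (0 < c i)%N.
Hypothesis BcA : forall i, B i ^+ c i = A.
Hypothesis BL : mx_cvg B L.

Lemma root_comm i : comm_mx (B i) A.
Proof. by rewrite comm_mxE -(BcA i); exact/commrX. Qed.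

Lemma limit_comm : comm_mx L A.
Proof.
apply: (@mx_cvg_unique _ _ _ (fun i => B i *m A)).
  exact: (mx_cvg_mul BL (mx_cvg_cst A)).
under eq_fun do rewrite root_comm.
exact: (mx_cvg_mul (mx_cvg_cst A) BL).
Qed.

(** A vector killed by a power of A is killed by a power of B_i, hence by
    B_i ^ (n + 1), n + 1 being the dimension. *)
Lemma kermx_pow_root : (kermx (A ^+ n.+1) <= kermx (L ^+ n.+1))%MS.
Proof.
apply/sub_kermxP; apply: (@mx_cvg_unique _ _ _ (fun i => kermx (A ^+ n.+1) *m B i ^+ n.+1)).
  exact: (mx_cvg_mul (mx_cvg_cst _) (mx_cvg_exp BL)).
have -> : (fun i => kermx (A ^+ n.+1) *m B i ^+ n.+1) = fun=> 0.
  apply/funext=> i; apply/sub_kermxP.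
  have := kermx_pow_sub (B i) 0 (c i * n.+1).
  by rewrite raddf0 subr0 exprM BcA.
exact: mx_cvg_cst.
Qed.

(** The restriction of L to the image I of A ^ (n + 1) is invertible, since the
    determinants of the restrictions of the B_i are roots of the nonzero
    determinant of that of A and so do not tend to 0. If u L ^ (n + 1) = 0, then u A ^ (n + 1) lies in I
    and is killed by L ^ (n + 1), hence vanishes. *)
Lemma kermx_pow_limit : (kermx (L ^+ n.+1) <= kermx (A ^+ n.+1))%MS.
Proof.
pose I := A ^+ n.+1; pose W := row_base I; pose restr X := conjmx W X.
have stableI X : comm_mx X A -> stablemx I X.
  by move=> XA; apply/comm_mx_stable/comm_mx_sym; rewrite comm_mxE; exact: commrX.
have restrW X j : comm_mx X A -> restr X ^+ j *m W = W *m X ^+ j.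
  move=> /stableI IX; have := restrictmx_sub_pow 0 j IX.
  by rewrite !raddf0 !addr0.
have restr_root i : restr (B i) ^+ c i = restr A.
  apply: (row_free_inj (row_base_free I)).
  by rewrite -/W (restrW _ _ (root_comm i)) BcA -[restr A]expr1 (restrW A 1%N) // expr1.
(* A maps I onto itself, as A ^ (n + 2) has the rank of A ^ (n + 1). *)
have unitA : restr A \in unitmx.
  rewrite -row_free_unit -row_leq_rank -(mxrankMfree _ (row_base_free I)).
  rewrite -/W -[restr A]expr1 restrW // expr1 (eqmxMr _ (eq_row_base I)).
  have rankE (X : 'M[C]_n.+1) : \rank X = (n.+1 - \rank (kermx X))%N.
    by rewrite mxrank_ker subKn ?rank_leq_row.
  rewrite mulmxE -exprSr rankE (rankE (A ^+ n.+2)) leq_sub2l // mxrankS //.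
  by have := kermx_pow_sub A 0 n.+2; rewrite raddf0 subr0.
have det_root_cvg : ((fun i => \det (restr (B i))) @ \oo --> \det (restr L))%classic.
  apply: mx_cvg_det; apply: (mx_cvg_mul _ (mx_cvg_cst _)).
  exact: (mx_cvg_mul (mx_cvg_cst _) BL).
have unitL : restr L \in unitmx.
  rewrite unitmxE unitfE; apply/eqP=> detL0; rewrite detL0 in det_root_cvg.
  move: unitA; rewrite unitmxE unitfE => /eqP; apply.
  apply: (eq0_of_roots_cvg0 c_gt0 _ det_root_cvg) => i.
  by rewrite -det_pow restr_root.
set K := kermx (L ^+ n.+1); apply/sub_kermxP.
have [S defS] : exists S, K *m I = S *m W.
  by apply/submxP; rewrite eq_row_base submxMl.
suff S0 : S = 0 by rewrite -/I defS S0 mul0mx.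
have unitLn : restr L ^+ n.+1 \in unitmx.
  by rewrite unitmxE det_pow unitrX // -unitmxE.
apply: (can_inj (mulmxK unitLn)); apply: (row_free_inj (row_base_free I)).
rewrite -/W !mul0mx -mulmxA restrW; last exact: limit_comm.
rewrite mulmxA -defS -mulmxA mulmxE.
have -> : I * L ^+ n.+1 = L ^+ n.+1 * I.
  by apply: commrX; apply/commr_sym/commrX; rewrite -comm_mxE; exact: limit_comm.
by rewrite -mulmxE mulmxA mulmx_ker mul0mx.
Qed.
End RootLimits.

(** * The multiplicity rearrangement matrix *)

Section RearrangementMatrix.
Variable C : numClosedFieldType.

Lemma root_limits_comm n (A L : 'M[C]_n.+1) : root_limits A L -> comm_mx A L.
Proof.
by move=> [c [B [_ _ BcA BL]]]; apply/comm_mx_sym/(limit_comm BcA)/mx_cvg_of_cvg.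
Qed.

Lemma root_limits_gen_eigenspace0 n (A L : 'M[C]_n.+1) :
  root_limits A L -> (gen_eigenspace 0 A == gen_eigenspace 0 L)%MS.
Proof.
move=> [c [B [c_gt0 _ BcA /mx_cvg_of_cvg/mx_cvg_tr BL]]].
have BcA' i : (B i)^T ^+ c i = A^T by rewrite -trmx_pow BcA.
rewrite /gen_eigenspace !geigenspaceE !raddf0 !addr0.
by rewrite (kermx_pow_root BcA' BL) (kermx_pow_limit c_gt0 BcA' BL).
Qed.

Lemma rearrangement_mxC n (A L : 'M[C]_n) lambda nu :
  rearrangement_mx L A nu lambda = rearrangement_mx A L lambda nu.
Proof. by rewrite /rearrangement_mx capmxC. Qed.

Lemma sigma_star_dim0 (X : 'M[C]_0) lambda : lambda \notin sigma_star X.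
Proof. by rewrite in_sigma_star /eigenvalue thinmx0 eqxx. Qed.

Lemma sum_rearrangement_mx n (A L : 'M[C]_n.+1) lambda :
    comm_mx A L -> (gen_eigenspace 0 A == gen_eigenspace 0 L)%MS ->
    lambda != 0 ->
  (\sum_(nu <- sigma_star L) rearrangement_mx A L lambda nu)%N = mult lambda A.
Proof.
move=> AL ker_AL nz; rewrite -rank_gen_eigenspace.
have stableE := gen_eigenspace_stable AL lambda.
by have [_] := split_sub_gen_eigenspace ker_AL nz (submx_refl _) stableE.
Qed.
End RearrangementMatrix.

Unset Implicit Arguments.

Theorem theorem3p4 (R : realType) (n : nat) (A L : 'M[R[i]]_n)
    (M : R[i] -> R[i] -> nat) (hL : root_limits A L)
    (hM : M = rearrangement_mx A L) :
  [/\
    (* 1 *)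
    forall lambda, lambda \in sigma_star A ->
      (exists2 parts : R[i] -> seq nat,
         multiset_partition (jordan_sizes lambda A) (sigma_star L) parts &
         forall nu, nu \in sigma_star L -> M lambda nu = sumn (parts nu)) /\
      (\sum_(nu <- sigma_star L) M lambda nu)%N = mult lambda A,
    (* 2 *)
    forall nu, nu \in sigma_star L ->
      (\sum_(lambda <- sigma_star A) M lambda nu)%N = mult nu L,
    (* 3 *)
    forall lambda, lambda \in sigma_star A ->
      (gen_eigenspace lambda A <=
         \sum_(nu <- sigma_star L | M lambda nu != 0%N)
            gen_eigenspace nu L)%MS /\
      ((forall nu, nu \in sigma_star L -> M lambda nu != 0%N ->
          mult nu L = M lambda nu) ->
       (gen_eigenspace lambda A ==
         \sum_(nu <- sigma_star L | M lambda nu != 0%N)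
            gen_eigenspace nu L)%MS) &
    (* 4 *)
    forall nu, nu \in sigma_star L ->
      (gen_eigenspace nu L <=
         \sum_(lambda <- sigma_star A | M lambda nu != 0%N)
            gen_eigenspace lambda A)%MS /\
      ((forall lambda, lambda \in sigma_star A -> M lambda nu != 0%N ->
          mult lambda A = M lambda nu) ->
       (gen_eigenspace nu L ==
         \sum_(lambda <- sigma_star A | M lambda nu != 0%N)
            gen_eigenspace lambda A)%MS)].
Proof.
case: n => [|n] in A L M hL hM *.
  by split=> [lambda|nu|lambda|nu]; rewrite (negPf (sigma_star_dim0 _ _)).
subst M; have AL := root_limits_comm hL.
have ker_AL := root_limits_gen_eigenspace0 hL.
have LA := comm_mx_sym AL.
have ker_LA : (gen_eigenspace 0 L == gen_eigenspace 0 A)%MS by rewrite andbC.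
have nz (X : 'M[R[i]]_n.+1) lambda : lambda \in sigma_star X -> lambda != 0.
  by rewrite in_sigma_star => /andP[].
split=> [lambda /nz nz_lambda|nu /nz nz_nu|lambda /nz nz_lambda|nu /nz nz_nu].
- split; last exact: sum_rearrangement_mx.
  have [part sum_part] := jordan_sizes_partition AL ker_AL nz_lambda.
  by eexists; [exact: part | move=> nu _; exact: sum_part].
- rewrite -(sum_rearrangement_mx LA ker_LA nz_nu).
  by under [RHS]eq_bigr do rewrite rearrangement_mxC.
- exact: (gen_eigenspace_sub AL ker_AL nz_lambda (fun=> erefl)).
apply: (gen_eigenspace_sub LA ker_LA nz_nu) => lambda.
exact: rearrangement_mxC.
Qed.
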